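(* The functor $\mathbf R:\mathcal{NCA}\to\mathcal{RL}_{\mathrm{cy}}$ is left adjoint to the functor $\mathbf T:\mathcal{RL}_{\mathrm{cy}}\to\mathcal{NCA}$. They form an adjunction between the categories $\mathcal{RL}_{\mathrm{cy}}$ and $\mathcal{NCA}$, with unit $\phi$ and counit $\psi^{-1}$, where $$\phi_{(\mathbf A,\mathbf n)}:(\mathbf A,\mathbf n)\to\mathbf{TR}(\mathbf A,\mathbf n),\quad \phi_{(\mathbf A,\mathbf n)}(x)=(\mathbf n(x),\mathbf n(\sim x)),$$ $$\psi_{(\mathbf L,\imath)}:(\mathbf L,\imath)\to\mathbf{RT}(\mathbf L,\imath),\quad \psi_{(\mathbf L,\imath)}(a)=(a,a\backslash\imath)$$ (each $\psi_{(\mathbf L,\imath)}$ being an isomorphism).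
   Context: A residuated lattice is an algebra $(A,\wedge,\vee,\cdot,\backslash,/,e)$ such that $(A,\wedge,\vee)$ is a lattice, $(A,\cdot,e)$ is a monoid, and $xy\le z$ iff $y\le x\backslash z$ iff $x\le z/y$. An involutive residuated lattice (always cyclic) is a residuated lattice with a unary operation $\sim$ satisfying $\sim\sim x=x$ and $x\backslash\sim y=\sim x/y$. An element $\imath$ is cyclic if $x\backslash\imath=\imath/x$ for all $x$. A conucleus on a residuated lattice $\mathbf A$ is a map $\delta:A\to A$ such that $\delta(x)\le x$; $\delta(\delta(x))=\delta(x)$; $x\le y$ implies $\delta(x)\le\delta(y)$; $\delta(x)\delta(y)\le\delta(xy)$; $\delta(e)\delta(x)=\delta(x)\delta(e)=\delta(x)$. A Nelson conucleus is a conucleus $\mathbf n$ with $\mathbf n(x\vee y)=\mathbf n(x)\vee\mathbf n(y)$, $\mathbf n(xy)=\mathbf n(x)\mathbf n(y)$ and $xy\le \mathbf n(x)y\vee x\mathbf n(y)$ (then $\mathbf n(e)=e$). Categories. $\mathcal{NCA}$: objects are pairs $(\mathbf A,\mathbf n)$ with $\mathbf A$ an involutive residuated lattice and $\mathbf n$ a Nelson conucleus on $\mathbf A$; morphisms are algebra homomorphisms (preserving all operations and $\mathbf n$). $\mathcal{RL}_{\mathrm{cy}}$: objects are pairs $(\mathbf L,\imath)$ with $\mathbf L$ a residuated lattice and $\imath\in L$ cyclic; morphisms are residuated lattice homomorphisms preserving the distinguished element $\imath$. Functors. $\mathbf T(\mathbf L,\imath)=(\mathbf{Tw}(\mathbf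 L,\imath),\mathbf n_{\mathrm{Tw}})$ and $\mathbf T(f)(a,b)=(f(a),f(b))$, where $\mathbf{Tw}(\mathbf L,\imath)$ is the involutive residuated lattice with universe $\{(a,b)\in L\times L: ab\vee ba\le\imath\}$, operations $(a,b)\wedge(a',b')=(a\wedge a',b\vee b')$, $(a,b)\vee(a',b')=(a\vee a',b\wedge b')$, $\sim(a,b)=(b,a)$, $(a,b)\cdot(a',b')=(aa',(b'/a)\wedge(a'\backslash b))$, $(a,b)\backslash(a',b')=((a\backslash a')\wedge(b/b'),b'a)$, $(a',b')/(a,b)=((a'/a)\wedge(b'\backslash b),ab')$, identity $(e,\imath)$, and $\mathbf n_{\mathrm{Tw}}(a,b)=(a,a\backslash\imath)$. $\mathbf R(\mathbf A,\mathbf n)=(\mathbf A_{\mathbf n},\mathbf n(\sim e))$ and $\mathbf R(f)$ is the restriction of $f$ to $\mathbf A_{\mathbf n}$, where $\mathbf A_{\mathbf n}=(\mathbf n[A],\wedge_{\mathbf n},\vee,\cdot,\backslash_{\mathbf n},/_{\mathbf n},e)$ with $x\wedge_{\mathbf n}y=\mathbf n(x\wedge y)$, $x\backslash_{\mathbf n}y=\mathbf n(x\backslash y)$, $y/_{\mathbf n}x=\mathbf n(y/x)$; this is a residuated lattice in which $\mathbf n(\sim e)$ is cyclic. *)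

(* Defs.v *)
From Stdlib Require Import FunctionalExtensionality ProofIrrelevance Setoid.

Set Implicit Arguments.
Unset Strict Implicit.
Unset Printing Implicit Defensive.

Record Category := MkCategory {
  Ob :> Type;
  Hom : Ob -> Ob -> Type;
  idm : forall X, Hom X X;
  compm : forall X Y Z, Hom Y Z -> Hom X Y -> Hom X Z;
  compm_id_l : forall X Y (f : Hom X Y), compm (idm Y) f = f;
  compm_id_r : forall X Y (f : Hom X Y), compm f (idm X) = f;
  compm_assoc : forall X Y Z W (h : Hom Z W) (g : Hom Y Z) (f : Hom X Y),
    compm h (compm g f) = compm (compm h g) f }.

Arguments Hom {_} _ _.
Arguments idm {_} _.
Arguments compm {_ _ _ _} _ _.

Record Functor (C D : Category) := MkFunctor {
  fob :> C -> D;
  fmap : forall X Y : C, Hom X Y -> Hom (fob X) (fob Y);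
  fmap_id : forall X : C, fmap (idm X) = idm (fob X);
  fmap_comp : forall (X Y Z : C) (g : Hom Y Z) (f : Hom X Y),
    fmap (compm g f) = compm (fmap g) (fmap f) }.

Arguments fmap {C D} _ {X Y} _.

Definition idF (C : Category) : Functor C C :=
  @MkFunctor C C (fun X => X) (fun X Y f => f)
    (fun X => eq_refl) (fun X Y Z g f => eq_refl).

Lemma compF_id (C D E : Category) (G : Functor D E) (F : Functor C D) (X : C) :
  fmap G (fmap F (idm X)) = idm (G (F X)).
Proof. now rewrite !fmap_id. Qed.

Lemma compF_comp (C D E : Category) (G : Functor D E) (F : Functor C D)
    (X Y Z : C) (g : Hom Y Z) (f : Hom X Y) :
  fmap G (fmap F (compm g f)) = compm (fmap G (fmap F g)) (fmap G (fmap F f)).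
Proof. now rewrite !fmap_comp. Qed.

Definition compF (C D E : Category) (G : Functor D E) (F : Functor C D) :
    Functor C E :=
  @MkFunctor C E (fun X => G (F X)) (fun X Y f => fmap G (fmap F f))
    (compF_id G F) (compF_comp G F).

Record NatTrans (C D : Category) (F G : Functor C D) := MkNatTrans {
  ntc :> forall X : C, Hom (F X) (G X);
  ntc_nat : forall (X Y : C) (f : Hom X Y),
    compm (ntc Y) (fmap F f) = compm (fmap G f) (ntc X) }.

Definition inverse_pair (C : Category) (X Y : C) (f : Hom X Y) (g : Hom Y X) :
    Prop :=
  compm g f = idm X /\ compm f g = idm Y.

(* F is left adjoint to G with unit eta and counit eps (triangle identities). *)
Definition is_adjunction (C D : Category) (F : Functor C D) (G : Functor D C)
    (eta : NatTrans (idF C) (compF G F)) (eps : NatTrans (compF F G) (idF D)) :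
    Prop :=
  (forall X : C, compm (eps (F X)) (fmap F (eta X)) = idm (F X)) /\
  (forall Y : D, compm (fmap G (eps Y)) (eta (G Y)) = idm (G Y)).

Declare Scope rl_scope.
Open Scope rl_scope.

(* [rl_ldiv x z] is x\z and [rl_rdiv z y] is z/y; the order is
   x <= y iff x meet y = x. *)
Record ResLat := MkResLat {
  rl_car :> Type;
  rl_meet : rl_car -> rl_car -> rl_car;
  rl_join : rl_car -> rl_car -> rl_car;
  rl_mul : rl_car -> rl_car -> rl_car;
  rl_ldiv : rl_car -> rl_car -> rl_car;
  rl_rdiv : rl_car -> rl_car -> rl_car;
  rl_e : rl_car;
  rl_meetC : forall x y, rl_meet x y = rl_meet y x;
  rl_meetA : forall x y z, rl_meet x (rl_meet y z) = rl_meet (rl_meet x y) z;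
  rl_joinC : forall x y, rl_join x y = rl_join y x;
  rl_joinA : forall x y z, rl_join x (rl_join y z) = rl_join (rl_join x y) z;
  rl_meetKU : forall x y, rl_meet x (rl_join x y) = x;
  rl_joinKI : forall x y, rl_join x (rl_meet x y) = x;
  rl_mulA : forall x y z, rl_mul x (rl_mul y z) = rl_mul (rl_mul x y) z;
  rl_mul1l : forall x, rl_mul rl_e x = x;
  rl_mul1r : forall x, rl_mul x rl_e = x;
  rl_resl : forall x y z,
    rl_meet (rl_mul x y) z = rl_mul x y <-> rl_meet y (rl_ldiv x z) = y;
  rl_resr : forall x y z,
    rl_meet (rl_mul x y) z = rl_mul x y <-> rl_meet x (rl_rdiv z y) = x }.

Arguments rl_meet {_} _ _.
Arguments rl_join {_} _ _.
Arguments rl_mul {_} _ _.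
Arguments rl_ldiv {_} _ _.
Arguments rl_rdiv {_} _ _.
Arguments rl_e {_}.

Definition rl_le (L : ResLat) (x y : L) : Prop := rl_meet x y = x.

Notation "x ⊓ y" := (rl_meet x y) (at level 48, left associativity) : rl_scope.
Notation "x ⊔ y" := (rl_join x y) (at level 49, left associativity) : rl_scope.
Notation "x ⊙ y" := (rl_mul x y) (at level 40, left associativity) : rl_scope.
Notation "x \\ y" := (rl_ldiv x y) (at level 44, no associativity) : rl_scope.
Notation "x // y" := (rl_rdiv x y) (at level 44, no associativity) : rl_scope.
Notation "x ⊑ y" := (rl_le x y) (at level 70, no associativity) : rl_scope.

Definition cyclic (L : ResLat) (i : L) : Prop := forall x : L, x \\ i = i // x.

Record is_rl_hom (L M : ResLat) (f : L -> M) : Prop := {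
  rlh_meet : forall x y, f (x ⊓ y) = f x ⊓ f y;
  rlh_join : forall x y, f (x ⊔ y) = f x ⊔ f y;
  rlh_mul : forall x y, f (x ⊙ y) = f x ⊙ f y;
  rlh_ldiv : forall x y, f (x \\ y) = f x \\ f y;
  rlh_rdiv : forall x y, f (x // y) = f x // f y;
  rlh_e : f rl_e = rl_e }.

Record InvResLat := MkInvResLat {
  irl_rl :> ResLat;
  irl_neg : irl_rl -> irl_rl;
  irl_negK : forall x, irl_neg (irl_neg x) = x;
  irl_neg_div : forall x y, x \\ irl_neg y = irl_neg x // y }.

Arguments irl_neg {_} _.

Record is_conucleus (A : ResLat) (d : A -> A) : Prop := {
  con_le : forall x, d x ⊑ x;
  con_idem : forall x, d (d x) = d x;
  con_mono : forall x y, x ⊑ y -> d x ⊑ d y;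
  con_mul : forall x y, d x ⊙ d y ⊑ d (x ⊙ y);
  con_e_l : forall x, d rl_e ⊙ d x = d x;
  con_e_r : forall x, d x ⊙ d rl_e = d x }.

Record is_nelson_conucleus (A : ResLat) (n : A -> A) : Prop := {
  nel_con :> is_conucleus n;
  nel_join : forall x y, n (x ⊔ y) = n x ⊔ n y;
  nel_mul : forall x y, n (x ⊙ y) = n x ⊙ n y;
  nel_le : forall x y, x ⊙ y ⊑ (n x ⊙ y) ⊔ (x ⊙ n y) }.

Record nca := MkNca {
  nca_alg :> InvResLat;
  nca_n : nca_alg -> nca_alg;
  nca_nelson : is_nelson_conucleus nca_n }.

Arguments nca_n {_} _.

Record nca_hom (A B : nca) := MkNcaHom {
  nca_fun :> A -> B;
  ncah_rl : is_rl_hom nca_fun;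
  ncah_neg : forall x : A, nca_fun (irl_neg x) = irl_neg (nca_fun x);
  ncah_n : forall x : A, nca_fun (nca_n x) = nca_n (nca_fun x) }.

Record rlcy := MkRlcy {
  rlcy_rl :> ResLat;
  rlcy_i : rlcy_rl;
  rlcy_cyclic : cyclic rlcy_i }.

Arguments rlcy_i {_}.

Record rlcy_hom (L M : rlcy) := MkRlcyHom {
  rlcy_fun :> L -> M;
  rlcyh_rl : is_rl_hom rlcy_fun;
  rlcyh_i : rlcy_fun rlcy_i = rlcy_i }.

Lemma nca_hom_eq (A B : nca) (f g : nca_hom A B) :
  (forall x, f x = g x) -> f = g.
Proof.
destruct f as [f f1 f2 f3], g as [g g1 g2 g3]; simpl; intro E.
apply functional_extensionality in E; subst g.
f_equal; apply proof_irrelevance.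
Qed.

Lemma rlcy_hom_eq (L M : rlcy) (f g : rlcy_hom L M) :
  (forall x, f x = g x) -> f = g.
Proof.
destruct f as [f f1 f2], g as [g g1 g2]; simpl; intro E.
apply functional_extensionality in E; subst g.
f_equal; apply proof_irrelevance.
Qed.

Lemma is_rl_hom_id (L : ResLat) : is_rl_hom (fun x : L => x).
Proof. now split. Qed.

Lemma is_rl_hom_comp (L M N : ResLat) (g : M -> N) (f : L -> M) :
  is_rl_hom g -> is_rl_hom f -> is_rl_hom (fun x => g (f x)).
Proof.
intros [g1 g2 g3 g4 g5 g6] [f1 f2 f3 f4 f5 f6]; split; intros; congruence.
Qed.

Definition nca_id (A : nca) : nca_hom A A :=
  @MkNcaHom A A (fun x => x) (is_rl_hom_id A)
    (fun x => eq_refl) (fun x => eq_refl).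

Lemma nca_comp_neg (A B C : nca) (g : nca_hom B C) (f : nca_hom A B) (x : A) :
  g (f (irl_neg x)) = irl_neg (g (f x)).
Proof. now rewrite !ncah_neg. Qed.

Lemma nca_comp_n (A B C : nca) (g : nca_hom B C) (f : nca_hom A B) (x : A) :
  g (f (nca_n x)) = nca_n (g (f x)).
Proof. now rewrite !ncah_n. Qed.

Definition nca_comp (A B C : nca) (g : nca_hom B C) (f : nca_hom A B) :
    nca_hom A C :=
  @MkNcaHom A C (fun x => g (f x)) (is_rl_hom_comp (ncah_rl g) (ncah_rl f))
    (nca_comp_neg g f) (nca_comp_n g f).

Definition NCA : Category.
Proof.
refine (@MkCategory nca nca_hom nca_id nca_comp _ _ _);
  intros; now apply nca_hom_eq.
Defined.

Definition rlcy_id (L : rlcy) : rlcy_hom L L :=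
  @MkRlcyHom L L (fun x => x) (is_rl_hom_id L) eq_refl.

Lemma rlcy_comp_i (L M N : rlcy) (g : rlcy_hom M N) (f : rlcy_hom L M) :
  g (f rlcy_i) = rlcy_i.
Proof. now rewrite !rlcyh_i. Qed.

Definition rlcy_comp (L M N : rlcy) (g : rlcy_hom M N) (f : rlcy_hom L M) :
    rlcy_hom L N :=
  @MkRlcyHom L N (fun x => g (f x)) (is_rl_hom_comp (rlcyh_rl g) (rlcyh_rl f))
    (rlcy_comp_i g f).

Definition RLcy : Category.
Proof.
refine (@MkCategory rlcy rlcy_hom rlcy_id rlcy_comp _ _ _);
  intros; now apply rlcy_hom_eq.
Defined.

Lemma meetxx (L : ResLat) (x : L) : x ⊓ x = x.
Proof. rewrite <- (rl_joinKI x x) at 2. apply rl_meetKU. Qed.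

Lemma joinxx (L : ResLat) (x : L) : x ⊔ x = x.
Proof. rewrite <- (rl_meetKU x x) at 2. apply rl_joinKI. Qed.

Lemma le_refl (L : ResLat) (x : L) : x ⊑ x.
Proof. apply meetxx. Qed.

Lemma le_trans (L : ResLat) (y x z : L) : x ⊑ y -> y ⊑ z -> x ⊑ z.
Proof.
unfold rl_le; intros H1 H2.
rewrite <- H1, <- rl_meetA. now rewrite H2.
Qed.

Lemma le_anti (L : ResLat) (x y : L) : x ⊑ y -> y ⊑ x -> x = y.
Proof. unfold rl_le; intros H1 H2. now rewrite <- H1, rl_meetC. Qed.

Lemma le_joinE (L : ResLat) (x y : L) : x ⊑ y <-> x ⊔ y = y.
Proof.
unfold rl_le; split; intro H.
- rewrite <- H, rl_joinC, rl_meetC. apply rl_joinKI.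
- rewrite <- H. apply rl_meetKU.
Qed.

Lemma le_meetl (L : ResLat) (x y : L) : x ⊓ y ⊑ x.
Proof. unfold rl_le. now rewrite rl_meetC, rl_meetA, meetxx. Qed.

Lemma le_meetr (L : ResLat) (x y : L) : x ⊓ y ⊑ y.
Proof. rewrite rl_meetC. apply le_meetl. Qed.

Lemma le_meetP (L : ResLat) (x y z : L) : z ⊑ x ⊓ y <-> z ⊑ x /\ z ⊑ y.
Proof.
split.
- intro H; split; eapply le_trans; try apply H; [apply le_meetl|apply le_meetr].
- unfold rl_le; intros [H1 H2]. now rewrite rl_meetA, H1, H2.
Qed.

Lemma le_joinl (L : ResLat) (x y : L) : x ⊑ x ⊔ y.
Proof. apply rl_meetKU. Qed.

Lemma le_joinr (L : ResLat) (x y : L) : y ⊑ x ⊔ y.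
Proof. rewrite rl_joinC. apply le_joinl. Qed.

Lemma le_joinP (L : ResLat) (x y z : L) : x ⊔ y ⊑ z <-> x ⊑ z /\ y ⊑ z.
Proof.
split.
- intro H; split; eapply le_trans; try apply H; [apply le_joinl|apply le_joinr].
- intros [H1 H2]. apply le_joinE in H1, H2. apply le_joinE.
  now rewrite <- rl_joinA, H2.
Qed.

Lemma ldivP (L : ResLat) (x y z : L) : x ⊙ y ⊑ z <-> y ⊑ x \\ z.
Proof. apply rl_resl. Qed.

Lemma rdivP (L : ResLat) (x y z : L) : x ⊙ y ⊑ z <-> x ⊑ z // y.
Proof. apply rl_resr. Qed.

Lemma le_eqP (L : ResLat) (x y : L) : (forall z, z ⊑ x <-> z ⊑ y) -> x = y.
Proof. intro H; apply le_anti; apply H, le_refl. Qed.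

Lemma le_mul2l (L : ResLat) (x y z : L) : y ⊑ z -> x ⊙ y ⊑ x ⊙ z.
Proof.
intro H. apply ldivP. apply (le_trans H). apply ldivP, le_refl.
Qed.

Lemma le_mul2r (L : ResLat) (x y z : L) : y ⊑ z -> y ⊙ x ⊑ z ⊙ x.
Proof.
intro H. apply rdivP. apply (le_trans H). apply rdivP, le_refl.
Qed.

Lemma mul_ldiv (L : ResLat) (x y : L) : x ⊙ (x \\ y) ⊑ y.
Proof. apply ldivP, le_refl. Qed.

Lemma mul_rdiv (L : ResLat) (x y : L) : (y // x) ⊙ x ⊑ y.
Proof. apply rdivP, le_refl. Qed.

Lemma cycP (L : rlcy) (x y : L) : x ⊙ y ⊑ rlcy_i <-> y ⊙ x ⊑ rlcy_i.
Proof. now rewrite ldivP, rdivP, (rlcy_cyclic (r := L)). Qed.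

Record tw (L : rlcy) := MkTw {
  tw_fst : L;
  tw_snd : L;
  tw_mem : (tw_fst ⊙ tw_snd) ⊔ (tw_snd ⊙ tw_fst) ⊑ rlcy_i }.

Lemma tw_eq (L : rlcy) (x y : tw L) :
  tw_fst x = tw_fst y -> tw_snd x = tw_snd y -> x = y.
Proof.
destruct x as [a b p], y as [c d q]; simpl; intros -> ->.
f_equal; apply proof_irrelevance.
Qed.

Lemma tw_memP (L : rlcy) (a b : L) :
  a ⊙ b ⊑ rlcy_i -> (a ⊙ b) ⊔ (b ⊙ a) ⊑ rlcy_i.
Proof. intro H; apply le_joinP; split; trivial; now apply cycP. Qed.

Lemma tw_mem1 (L : rlcy) (x : tw L) : tw_fst x ⊙ tw_snd x ⊑ rlcy_i.
Proof. exact (proj1 (proj1 (le_joinP _ _ _) (tw_mem x))). Qed.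

Lemma tw_mem2 (L : rlcy) (x : tw L) : tw_snd x ⊙ tw_fst x ⊑ rlcy_i.
Proof. exact (proj2 (proj1 (le_joinP _ _ _) (tw_mem x))). Qed.

Lemma tw_neg_mem (L : rlcy) (x : tw L) :
  (tw_snd x ⊙ tw_fst x) ⊔ (tw_fst x ⊙ tw_snd x) ⊑ rlcy_i.
Proof. apply tw_memP, tw_mem2. Qed.

Definition tw_neg (L : rlcy) (x : tw L) : tw L := MkTw (tw_neg_mem x).

Lemma tw_meet_mem (L : rlcy) (x y : tw L) :
  let a := tw_fst x ⊓ tw_fst y in let b := tw_snd x ⊔ tw_snd y in
  (a ⊙ b) ⊔ (b ⊙ a) ⊑ rlcy_i.
Proof.
intros a b; apply tw_memP, ldivP, le_joinP; split; apply ldivP.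
- apply (le_trans (y := tw_fst x ⊙ tw_snd x)); [|apply tw_mem1].
  apply le_mul2r, le_meetl.
- apply (le_trans (y := tw_fst y ⊙ tw_snd y)); [|apply tw_mem1].
  apply le_mul2r, le_meetr.
Qed.

Definition tw_meet (L : rlcy) (x y : tw L) : tw L := MkTw (tw_meet_mem x y).

Lemma tw_join_mem (L : rlcy) (x y : tw L) :
  let a := tw_fst x ⊔ tw_fst y in let b := tw_snd x ⊓ tw_snd y in
  (a ⊙ b) ⊔ (b ⊙ a) ⊑ rlcy_i.
Proof.
intros a b. unfold a, b. rewrite rl_joinC.
exact (tw_meet_mem (tw_neg x) (tw_neg y)).
Qed.

Definition tw_join (L : rlcy) (x y : tw L) : tw L := MkTw (tw_join_mem x y).

Lemma tw_mul_mem (L : rlcy) (x y : tw L) :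
  let a := tw_fst x ⊙ tw_fst y in
  let b := (tw_snd y // tw_fst x) ⊓ (tw_fst y \\ tw_snd x) in
  (a ⊙ b) ⊔ (b ⊙ a) ⊑ rlcy_i.
Proof.
intros a b; apply tw_memP; unfold a, b. rewrite <- rl_mulA.
apply (le_trans (y := tw_fst x ⊙ tw_snd x)); [|apply tw_mem1].
apply le_mul2l, ldivP, le_meetr.
Qed.

Definition tw_mul (L : rlcy) (x y : tw L) : tw L := MkTw (tw_mul_mem x y).

Lemma tw_ldiv_mem (L : rlcy) (x y : tw L) :
  let a := (tw_fst x \\ tw_fst y) ⊓ (tw_snd x // tw_snd y) in
  let b := tw_snd y ⊙ tw_fst x in
  (a ⊙ b) ⊔ (b ⊙ a) ⊑ rlcy_i.
Proof.
intros a b; apply tw_memP; unfold a, b. rewrite rl_mulA.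
apply (le_trans (y := tw_snd x ⊙ tw_fst x)); [|apply tw_mem2].
apply le_mul2r, rdivP, le_meetr.
Qed.

Definition tw_ldiv (L : rlcy) (x y : tw L) : tw L := MkTw (tw_ldiv_mem x y).

(* The arguments are in the order of y / x. *)
Lemma tw_rdiv_mem (L : rlcy) (y x : tw L) :
  let a := (tw_fst y // tw_fst x) ⊓ (tw_snd y \\ tw_snd x) in
  let b := tw_fst x ⊙ tw_snd y in
  (a ⊙ b) ⊔ (b ⊙ a) ⊑ rlcy_i.
Proof.
intros a b; apply tw_memP, cycP; unfold a, b. rewrite <- rl_mulA.
apply (le_trans (y := tw_fst x ⊙ tw_snd x)); [|apply tw_mem1].
apply le_mul2l, ldivP, le_meetr.
Qed.

Definition tw_rdiv (L : rlcy) (y x : tw L) : tw L := MkTw (tw_rdiv_mem y x).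

Lemma tw_e_mem (L : rlcy) :
  (rl_e ⊙ rlcy_i) ⊔ (rlcy_i ⊙ rl_e) ⊑ (rlcy_i : L).
Proof. apply tw_memP. rewrite rl_mul1l. apply le_refl. Qed.

Definition tw_e (L : rlcy) : tw L := MkTw (tw_e_mem L).

Lemma tw_n_mem (L : rlcy) (x : tw L) :
  let a := tw_fst x in let b := tw_fst x \\ rlcy_i in
  (a ⊙ b) ⊔ (b ⊙ a) ⊑ rlcy_i.
Proof. intros a b; apply tw_memP, mul_ldiv. Qed.

Definition tw_n (L : rlcy) (x : tw L) : tw L := MkTw (tw_n_mem x).

Lemma tw_leP (L : rlcy) (x y : tw L) :
  tw_meet x y = x <-> tw_fst x ⊑ tw_fst y /\ tw_snd y ⊑ tw_snd x.
Proof.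
rewrite (le_joinE (tw_snd y)), rl_joinC; split.
- intro H; split; [exact (f_equal (@tw_fst L) H)|exact (f_equal (@tw_snd L) H)].
- intros [H1 H2]; apply tw_eq; assumption.
Qed.

Definition Tw_rl (L : rlcy) : ResLat.
Proof.
refine (@MkResLat (tw L) (@tw_meet L) (@tw_join L) (@tw_mul L) (@tw_ldiv L)
  (@tw_rdiv L) (tw_e L) _ _ _ _ _ _ _ _ _ _ _).
- intros x y; apply tw_eq; [apply rl_meetC|apply rl_joinC].
- intros x y z; apply tw_eq; [apply rl_meetA|apply rl_joinA].
- intros x y; apply tw_eq; [apply rl_joinC|apply rl_meetC].
- intros x y z; apply tw_eq; [apply rl_joinA|apply rl_meetA].
- intros x y; apply tw_eq; [apply rl_meetKU|apply rl_joinKI].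
- intros x y; apply tw_eq; [apply rl_joinKI|apply rl_meetKU].
- intros x y z; apply tw_eq; [apply rl_mulA|simpl].
  apply le_eqP; intro t.
  rewrite !le_meetP, <- !rdivP, <- !ldivP, !le_meetP, <- !rdivP, <- !ldivP.
  rewrite !rl_mulA; tauto.
- intros x; apply tw_eq; [apply rl_mul1l|simpl].
  apply le_eqP; intro t.
  rewrite !le_meetP, <- !rdivP, <- !ldivP, rl_mul1r; split; [tauto|].
  intro H; split; trivial.
  apply (le_trans (y := tw_fst x ⊙ tw_snd x)); [|apply tw_mem1].
  now apply le_mul2l.
- intros x; apply tw_eq; [apply rl_mul1r|simpl].
  apply le_eqP; intro t.
  rewrite !le_meetP, <- !rdivP, <- !ldivP, rl_mul1l; split; [tauto|].
  intro H; split; trivial.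
  apply (le_trans (y := tw_snd x ⊙ tw_fst x)); [|apply tw_mem2].
  now apply le_mul2r.
- intros x y z; rewrite !tw_leP; simpl.
  rewrite !le_meetP, <- !rdivP, <- !ldivP; tauto.
- intros x y z; rewrite !tw_leP; simpl.
  rewrite !le_meetP, <- !rdivP, <- !ldivP; tauto.
Defined.

Definition Tw (L : rlcy) : InvResLat.
Proof.
refine (@MkInvResLat (Tw_rl L) (@tw_neg L) _ _).
- intro x; now apply tw_eq.
- intros x y; apply tw_eq; [apply rl_meetC|reflexivity].
Defined.

Lemma tw_n_nelson (L : rlcy) : @is_nelson_conucleus (Tw L) (@tw_n L).
Proof.
split; [split|..].
- intro x; apply tw_leP; simpl; split; [apply le_refl|].
  apply ldivP, tw_mem1.
- intro x; now apply tw_eq.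
- intros x y H; apply tw_leP in H; apply tw_leP; simpl.
  destruct H as [H _]; split; trivial.
  apply ldivP. apply (le_trans (y := tw_fst y ⊙ (tw_fst y \\ rlcy_i))).
  + now apply le_mul2r.
  + apply mul_ldiv.
- intros x y; apply tw_leP; simpl; split; [apply le_refl|].
  apply le_meetP; rewrite <- rdivP, <- !ldivP; split.
  + apply cycP. rewrite <- rl_mulA. apply cycP, mul_ldiv.
  + rewrite rl_mulA. apply mul_ldiv.
- intro x; apply tw_eq; [apply rl_mul1l|simpl].
  apply le_eqP; intro t.
  rewrite le_meetP, <- rdivP, <- !ldivP, !rl_mul1r, rl_mul1l; tauto.
- intro x; apply tw_eq; [apply rl_mul1r|simpl].
  apply le_eqP; intro t.
  rewrite le_meetP, <- rdivP, <- !ldivP, !rl_mul1l, (cycP (tw_fst x)); tauto.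
- intros x y; apply tw_eq; [reflexivity|simpl].
  apply le_eqP; intro t.
  rewrite le_meetP, <- !ldivP, cycP, (cycP (tw_fst x)), (cycP (tw_fst y)).
  now rewrite ldivP, le_joinP, <- !ldivP.
- intros x y; apply tw_eq; [reflexivity|simpl].
  apply le_eqP; intro t.
  rewrite le_meetP, <- rdivP, <- !ldivP, !rl_mulA, (cycP _ (tw_fst x)).
  rewrite !rl_mulA; tauto.
- intros x y; apply tw_leP; simpl; split.
  + apply le_joinl.
  + apply le_meetP; split.
    * eapply le_trans; [apply le_meetl|apply le_meetl].
    * eapply le_trans; [apply le_meetr|apply le_meetr].
Qed.

Definition T_ob (L : rlcy) : nca := @MkNca (Tw L) (@tw_n L) (tw_n_nelson L).

Lemma T_fun_mem (L M : rlcy) (f : rlcy_hom L M) (x : tw L) :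
  (f (tw_fst x) ⊙ f (tw_snd x)) ⊔ (f (tw_snd x) ⊙ f (tw_fst x)) ⊑ rlcy_i.
Proof.
pose proof (rlcyh_rl f) as F.
rewrite <- !(rlh_mul F), <- (rlh_join F), <- (rlcyh_i f).
unfold rl_le. rewrite <- (rlh_meet F). f_equal. apply tw_mem.
Qed.

Definition T_fun (L M : rlcy) (f : rlcy_hom L M) (x : tw L) : tw M :=
  MkTw (T_fun_mem f x).

Definition T_hom (L M : rlcy) (f : rlcy_hom L M) : nca_hom (T_ob L) (T_ob M).
Proof.
refine (@MkNcaHom (T_ob L) (T_ob M) (T_fun f) _ _ _);
  pose proof (rlcyh_rl f) as [F1 F2 F3 F4 F5 F6]; pose proof (rlcyh_i f) as F7.
- split; intros; apply tw_eq; simpl; congruence.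
- intros; now apply tw_eq.
- intros; apply tw_eq; simpl; congruence.
Defined.

Definition T : Functor RLcy NCA.
Proof.
refine (@MkFunctor RLcy NCA T_ob T_hom _ _);
  intros; apply nca_hom_eq; intro; now apply tw_eq.
Defined.

Lemma nelson_e (A : nca) : nca_n (rl_e : A) = rl_e.
Proof.
pose proof (nca_nelson A) as N; apply le_anti; [apply (con_le N)|].
pose proof (nel_le N rl_e rl_e) as H.
now rewrite !rl_mul1l, rl_mul1r, joinxx in H.
Qed.

Record nimg (A : nca) := MkNimg {
  nval :> A;
  nval_mem : exists y : A, nca_n y = nval }.

Lemma nimg_eq (A : nca) (x y : nimg A) : nval x = nval y -> x = y.
Proof.
destruct x as [x p], y as [y q]; simpl; intros ->.
f_equal; apply proof_irrelevance.
Qed.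

Lemma nvalK (A : nca) (x : nimg A) : nca_n (nval x) = nval x.
Proof.
destruct x as [x [y <-]]; simpl. apply (con_idem (nca_nelson A)).
Qed.

Definition nimg_n (A : nca) (x : A) : nimg A :=
  MkNimg (ex_intro (fun y : A => nca_n y = nca_n x) x eq_refl).

Lemma nimg_join_mem (A : nca) (x y : nimg A) :
  exists z : A, nca_n z = nval x ⊔ nval y.
Proof.
exists (nval x ⊔ nval y). rewrite (nel_join (nca_nelson A)). now rewrite !nvalK.
Qed.

Lemma nimg_mul_mem (A : nca) (x y : nimg A) :
  exists z : A, nca_n z = nval x ⊙ nval y.
Proof.
exists (nval x ⊙ nval y). rewrite (nel_mul (nca_nelson A)). now rewrite !nvalK.
Qed.

Definition nimg_meet (A : nca) (x y : nimg A) : nimg A :=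
  nimg_n (nval x ⊓ nval y).
Definition nimg_join (A : nca) (x y : nimg A) : nimg A :=
  MkNimg (nimg_join_mem x y).
Definition nimg_mul (A : nca) (x y : nimg A) : nimg A :=
  MkNimg (nimg_mul_mem x y).
Definition nimg_ldiv (A : nca) (x y : nimg A) : nimg A :=
  nimg_n (nval x \\ nval y).
Definition nimg_rdiv (A : nca) (y x : nimg A) : nimg A :=
  nimg_n (nval y // nval x).
Definition nimg_e (A : nca) : nimg A :=
  MkNimg (ex_intro (fun y : A => nca_n y = rl_e) rl_e (nelson_e A)).

Lemma nca_nP (A : nca) (x : nimg A) (y : A) :
  nval x ⊑ nca_n y <-> nval x ⊑ y.
Proof.
pose proof (nca_nelson A) as N; split; intro H.
- apply (le_trans H), (con_le N).
- rewrite <- nvalK. now apply (con_mono N).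
Qed.

Lemma nimg_leP (A : nca) (x y : nimg A) :
  nimg_meet x y = x <-> nval x ⊑ nval y.
Proof.
split.
- intro H; apply (f_equal (@nval A)) in H; simpl in H.
  rewrite <- H at 1.
  eapply le_trans; [apply (con_le (nca_nelson A))|apply le_meetr].
- intro H; apply nimg_eq; simpl. rewrite H. apply nvalK.
Qed.

Lemma nimg_eqP (A : nca) (x y : nimg A) :
  (forall z : nimg A, nval z ⊑ nval x <-> nval z ⊑ nval y) -> x = y.
Proof. intro H; apply nimg_eq, le_anti; apply H, le_refl. Qed.

Definition nimg_rl (A : nca) : ResLat.
Proof.
refine (@MkResLat (nimg A) (@nimg_meet A) (@nimg_join A) (@nimg_mul A)
  (@nimg_ldiv A) (@nimg_rdiv A) (nimg_e A) _ _ _ _ _ _ _ _ _ _ _).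
- intros x y; apply nimg_eq; simpl. now rewrite rl_meetC.
- intros x y z; apply nimg_eqP; intro t; simpl.
  rewrite !nca_nP, !le_meetP, !nca_nP, !le_meetP; tauto.
- intros x y; apply nimg_eq; apply rl_joinC.
- intros x y z; apply nimg_eq; apply rl_joinA.
- intros x y; apply nimg_eq; simpl. rewrite rl_meetKU. apply nvalK.
- intros x y; apply nimg_eq; simpl. rewrite rl_joinC. apply le_joinE.
  eapply le_trans; [apply (con_le (nca_nelson A))|apply le_meetl].
- intros x y z; apply nimg_eq; apply rl_mulA.
- intros x; apply nimg_eq; apply rl_mul1l.
- intros x; apply nimg_eq; apply rl_mul1r.
- intros x y z; rewrite !nimg_leP; simpl. now rewrite nca_nP, ldivP.
- intros x y z; rewrite !nimg_leP; simpl. now rewrite nca_nP, rdivP.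
Defined.

Lemma nimg_cyclic (A : nca) :
  @cyclic (nimg_rl A) (nimg_n (irl_neg (rl_e : A))).
Proof.
assert (H1 : forall x : A, x \\ irl_neg rl_e = irl_neg x).
{ intro x. rewrite irl_neg_div. apply le_eqP; intro t.
  now rewrite <- rdivP, rl_mul1r. }
assert (H2 : forall x : A, irl_neg rl_e // x = irl_neg x).
{ intro x. rewrite <- irl_neg_div. apply le_eqP; intro t.
  now rewrite <- ldivP, rl_mul1l. }
intro x; apply nimg_eqP; intro t; simpl.
rewrite !nca_nP, <- ldivP, <- rdivP.
change (nval (nimg_mul x t) ⊑ nca_n (irl_neg rl_e) <->
        nval (nimg_mul t x) ⊑ nca_n (irl_neg rl_e)).
rewrite !nca_nP; simpl.
now rewrite ldivP, rdivP, H1, H2.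
Qed.

Definition R_ob (A : nca) : rlcy :=
  @MkRlcy (nimg_rl A) (nimg_n (irl_neg rl_e)) (nimg_cyclic (A := A)).

Lemma R_fun_mem (A B : nca) (f : nca_hom A B) (x : nimg A) :
  exists y : B, nca_n y = f (nval x).
Proof. exists (f (nval x)). now rewrite <- ncah_n, nvalK. Qed.

Definition R_fun (A B : nca) (f : nca_hom A B) (x : nimg A) : nimg B :=
  MkNimg (R_fun_mem f x).

Definition R_hom (A B : nca) (f : nca_hom A B) : rlcy_hom (R_ob A) (R_ob B).
Proof.
refine (@MkRlcyHom (R_ob A) (R_ob B) (R_fun f) _ _);
  pose proof (ncah_rl f) as [F1 F2 F3 F4 F5 F6];
  pose proof (ncah_neg f) as F7; pose proof (ncah_n f) as F8.
- split; intros; apply nimg_eq; simpl; congruence.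
- apply nimg_eq; simpl; congruence.
Defined.

Definition R : Functor NCA RLcy.
Proof.
refine (@MkFunctor NCA RLcy R_ob R_hom _ _);
  intros; apply rlcy_hom_eq; intro; now apply nimg_eq.
Defined.

Lemma phi_mem (A : nca) (x : A) :
  let a := nimg_n x : R_ob A in let b := nimg_n (irl_neg x) : R_ob A in
  (a ⊙ b) ⊔ (b ⊙ a) ⊑ rlcy_i.
Proof.
intros a b. apply tw_memP. apply nimg_leP. simpl.
pose proof (nca_nelson A) as N.
rewrite <- (nel_mul N). apply (con_mono N).
apply ldivP. rewrite irl_neg_div. apply rdivP. rewrite rl_mul1r.
apply le_refl.
Qed.

(* x |-> (n(x), n(~x)) *)
Definition phi_fun (A : nca) (x : A) : tw (R_ob A) := MkTw (phi_mem x).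

Definition psi_pair (L : rlcy) (a : L) : tw L :=
  @MkTw L a (a \\ rlcy_i) (tw_memP (mul_ldiv a rlcy_i)).

Lemma psi_mem (L : rlcy) (a : L) :
  exists y : T_ob L, nca_n y = psi_pair a.
Proof. exists (psi_pair a). now apply tw_eq. Qed.

(* a |-> (a, a\i) *)
Definition psi_fun (L : rlcy) (a : L) : nimg (T_ob L) :=
  @MkNimg (T_ob L) (psi_pair a) (psi_mem a).

(* Main.v *)
Require Import Defs.

(** The only non-formal point is that [phi] preserves multiplication.  In an
    involutive residuated lattice, [t <= ~(xy)] iff [txy <= ~e], and [~e] is
    cyclic.  The inequality [xy <= n(x)y \/ x n(y)] splits this condition into
    [t n(x) <= ~y] and [n(y) t <= ~x], which is exactly the second component of
    the twist product.  The divisions follow since [x\y = ~(~y x)] and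
    [y/x = ~(x ~y)].  On the other side, an element [(a, b)] of
    [n_Tw[Tw(L, i)]] has [b = a\i], hence is determined by [a]; so the first
    projection is a bijective homomorphism, and its inverse is [psi]. *)

Set Implicit Arguments.
Unset Strict Implicit.
Unset Printing Implicit Defensive.

Lemma ldiv_neg_e (A : InvResLat) (x : A) : x \\ irl_neg rl_e = irl_neg x.
Proof.
rewrite irl_neg_div. apply le_eqP; intro t. now rewrite <- rdivP, rl_mul1r.
Qed.

Lemma rdiv_neg_e (A : InvResLat) (x : A) : irl_neg rl_e // x = irl_neg x.
Proof.
rewrite <- irl_neg_div. apply le_eqP; intro t. now rewrite <- ldivP, rl_mul1l.
Qed.

Lemma le_negP (A : InvResLat) (x y : A) :
  x ⊑ irl_neg y <-> x ⊙ y ⊑ irl_neg rl_e.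
Proof. now rewrite rdivP, rdiv_neg_e. Qed.

(** Both residuals of [irl_neg rl_e] by [x] are [irl_neg x], so products below it may be rotated. *)
Lemma mul_le_neg_eC (A : InvResLat) (x y : A) :
  x ⊙ y ⊑ irl_neg rl_e <-> y ⊙ x ⊑ irl_neg rl_e.
Proof. now rewrite ldivP, rdivP, ldiv_neg_e, rdiv_neg_e. Qed.

(** Negation is thus an antitone Galois connection with itself, whence the De Morgan laws. *)
Lemma le_negC (A : InvResLat) (x y : A) : x ⊑ irl_neg y <-> y ⊑ irl_neg x.
Proof. now rewrite (le_negP x), (le_negP y), mul_le_neg_eC. Qed.

Lemma neg_join (A : InvResLat) (x y : A) :
  irl_neg (x ⊔ y) = irl_neg x ⊓ irl_neg y.
Proof.
apply le_eqP; intro t.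
now rewrite le_meetP, le_negC, le_joinP, (le_negC x), (le_negC y).
Qed.

Lemma neg_meet (A : InvResLat) (x y : A) :
  irl_neg (x ⊓ y) = irl_neg x ⊔ irl_neg y.
Proof.
rewrite <- (irl_negK (irl_neg x ⊔ irl_neg y)), neg_join. now rewrite !irl_negK.
Qed.

Lemma ldiv_neg_mul (A : InvResLat) (x y : A) :
  x \\ y = irl_neg (irl_neg y ⊙ x).
Proof.
apply le_eqP; intro t.
rewrite le_negP, mul_le_neg_eC, <- rl_mulA, mul_le_neg_eC, <- le_negP.
now rewrite irl_negK, ldivP.
Qed.

Lemma rdiv_neg_mul (A : InvResLat) (x y : A) :
  y // x = irl_neg (x ⊙ irl_neg y).
Proof.
apply le_eqP; intro t.
now rewrite le_negP, rl_mulA, <- le_negP, irl_negK, rdivP.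
Qed.

(** Needed because meets in the image are themselves corrected by [n]. Both sides lie in the image,
    so testing against image elements suffices, and for these being below [n z] or below [z] is the
    same. *)
Lemma n_meet_n (A : nca) (x y : A) :
  nca_n (x ⊓ y) = nca_n (nca_n x ⊓ nca_n y).
Proof.
apply (f_equal (@nval A)) with (x := nimg_n (x ⊓ y))
  (y := nimg_n (nca_n x ⊓ nca_n y)).
apply nimg_eqP; intro t; simpl. now rewrite !nca_nP, !le_meetP, !nca_nP.
Qed.

Lemma phi_fun_neg (A : nca) (x : A) :
  phi_fun (irl_neg x) = tw_neg (phi_fun x).
Proof. apply tw_eq; apply nimg_eq; simpl; now rewrite ?irl_negK. Qed.

Lemma phi_fun_mul (A : nca) (x y : A) :
  phi_fun (x ⊙ y) = tw_mul (phi_fun x) (phi_fun y).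
Proof.
pose proof (nca_nelson A) as N; pose proof (con_le N) as Nle.
apply tw_eq; [apply nimg_eq; apply (nel_mul N)|].
apply nimg_eqP; intro t; simpl.
rewrite !nca_nP, le_meetP, !nca_nP, <- rdivP, <- ldivP.
(* Seeing the products as elements of the image lets [nca_nP] remove the outer [n]. *)
change (nval t ⊑ irl_neg (x ⊙ y) <->
  nval (nimg_mul t (nimg_n x)) ⊑ nca_n (irl_neg y) /\
  nval (nimg_mul (nimg_n y) t) ⊑ nca_n (irl_neg x)).
rewrite !nca_nP; simpl.
rewrite (le_negP t), (le_negP (t ⊙ nca_n x)), (le_negP (nca_n y ⊙ t)).
(* Rotation brings all three conditions to the form [t ⊙ w ⊑ irl_neg rl_e], with [w] equal to
   [x ⊙ y], [nca_n x ⊙ y] and [x ⊙ nca_n y]. *)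
rewrite <- (rl_mulA t), (mul_le_neg_eC (nca_n y ⊙ t)), (rl_mulA x),
  (mul_le_neg_eC (x ⊙ nca_n y)).
split.
- intro H; split; (eapply le_trans; [apply le_mul2l|exact H]).
  + apply le_mul2r, Nle.
  + apply le_mul2l, Nle.
- intros [H1 H2].
  eapply le_trans; [apply le_mul2l, (nel_le N)|].
  now apply ldivP, le_joinP; rewrite <- !ldivP.
Qed.

Lemma phi_fun_hom (A : nca) : @is_rl_hom A (T_ob (R_ob A)) (@phi_fun A).
Proof.
pose proof (nca_nelson A) as N.
assert (M : forall x y : A, phi_fun (x ⊙ y) =
          (phi_fun x : T_ob (R_ob A)) ⊙ phi_fun y) by apply phi_fun_mul.
assert (G : forall x : A, phi_fun (irl_neg x) =
          irl_neg (phi_fun x : T_ob (R_ob A))) by apply phi_fun_neg.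
split.
- intros x y; apply tw_eq; apply nimg_eq; simpl; [apply n_meet_n|].
  now rewrite neg_meet, (nel_join N).
- intros x y; apply tw_eq; apply nimg_eq; simpl; [apply (nel_join N)|].
  rewrite neg_join. apply n_meet_n.
- exact M.
- intros x y; now rewrite !ldiv_neg_mul, G, M, G.
- intros x y; now rewrite !rdiv_neg_mul, G, M, G.
- apply tw_eq; apply nimg_eq; simpl; [apply nelson_e|reflexivity].
Qed.

(** For [t] in the image, lying below either second component means that [nca_n x ⊙ t] is below
    [irl_neg rl_e]. *)
Lemma phi_fun_n (A : nca) (x : A) : phi_fun (nca_n x) = tw_n (phi_fun x).
Proof.
apply tw_eq; [apply nimg_eq; apply (con_idem (nca_nelson A))|].
apply nimg_eqP; intro t; simpl.
rewrite !nca_nP, <- ldivP.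
change (nval t ⊑ irl_neg (nca_n x) <->
  nval (nimg_mul (nimg_n x) t) ⊑ nca_n (irl_neg rl_e)).
rewrite nca_nP; simpl. now rewrite le_negP, mul_le_neg_eC.
Qed.

Definition phi_hom (A : nca) : nca_hom A (T_ob (R_ob A)) :=
  @MkNcaHom A (T_ob (R_ob A)) (@phi_fun A) (phi_fun_hom A)
    (@phi_fun_neg A) (@phi_fun_n A).

Definition phi_nat : NatTrans (idF NCA) (compF T R).
Proof.
refine (@MkNatTrans NCA NCA (idF NCA) (compF T R) phi_hom _).
intros A B f; apply nca_hom_eq; intro x; apply tw_eq; apply nimg_eq; simpl.
- now rewrite ncah_n.
- now rewrite ncah_n, ncah_neg.
Defined.

(** The underlying map of the counit, inverse to [psi_fun]. *)
Definition nimg_fst (L : rlcy) (x : nimg (T_ob L)) : L := tw_fst (nval x).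

Lemma nimg_snd (L : rlcy) (x : nimg (T_ob L)) :
  tw_snd (nval x) = nimg_fst x \\ rlcy_i.
Proof. exact (f_equal (@tw_snd L) (eq_sym (nvalK x))). Qed.

Lemma psi_funK (L : rlcy) (a : L) : nimg_fst (psi_fun a) = a.
Proof. reflexivity. Qed.

Lemma nimg_fstK (L : rlcy) (x : nimg (T_ob L)) : psi_fun (nimg_fst x) = x.
Proof.
apply nimg_eq, tw_eq; [reflexivity|]. symmetry; apply nimg_snd.
Qed.

(** Only the divisions need an argument: their first coordinate in the twist product is a meet,
    whose second term is absorbed once second coordinates have the form [a \\ rlcy_i]. *)
Lemma nimg_fst_hom (L : rlcy) :
  @is_rl_hom (R_ob (T_ob L)) L (@nimg_fst L).
Proof.
split; try reflexivity; intros x y.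
- change ((nimg_fst x \\ nimg_fst y) ⊓ (tw_snd (nval x) // tw_snd (nval y)) =
    nimg_fst x \\ nimg_fst y).
  apply rdivP; rewrite !nimg_snd, <- ldivP, rl_mulA.
  eapply le_trans; [apply le_mul2r, mul_ldiv|apply mul_ldiv].
- change ((nimg_fst x // nimg_fst y) ⊓ (tw_snd (nval x) \\ tw_snd (nval y)) =
    nimg_fst x // nimg_fst y).
  (* Cyclicity turns [a \\ rlcy_i] into [rlcy_i // a], so the mirror image of the previous case
     applies. *)
  apply ldivP; rewrite !nimg_snd, !(rlcy_cyclic (r := L)).
  rewrite <- rdivP, <- rl_mulA.
  eapply le_trans; [apply le_mul2l, mul_rdiv|apply mul_rdiv].
Qed.

(** Transfers the homomorphism property from the first projection to [psi_fun]. *)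
Lemma is_rl_hom_inverse (L M : ResLat) (f : L -> M) (g : M -> L) :
  (forall x, g (f x) = x) -> (forall y, f (g y) = y) ->
  is_rl_hom f -> is_rl_hom g.
Proof.
intros fK gK [F1 F2 F3 F4 F5 F6].
split; intros; rewrite <- fK; f_equal; rewrite ?F1, ?F2, ?F3, ?F4, ?F5, ?gK;
  congruence.
Qed.

Lemma psi_fun_hom (L : rlcy) : @is_rl_hom L (R_ob (T_ob L)) (@psi_fun L).
Proof.
apply (is_rl_hom_inverse (f := @nimg_fst L) (L := R_ob (T_ob L))).
- apply nimg_fstK.
- apply psi_funK.
- apply nimg_fst_hom.
Qed.

Definition psi_inv_hom (L : rlcy) : rlcy_hom (R_ob (T_ob L)) L :=
  @MkRlcyHom (R_ob (T_ob L)) L (@nimg_fst L) (nimg_fst_hom L) eq_refl.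

(** The distinguished element on the right comes from the negated identity [(rlcy_i, rl_e)], so its
    first coordinate is [rlcy_i]. *)
Lemma psi_fun_i (L : rlcy) : psi_fun (rlcy_i : L) = (rlcy_i : R_ob (T_ob L)).
Proof. exact (nimg_fstK (rlcy_i : R_ob (T_ob L))). Qed.

Definition psi_hom (L : rlcy) : rlcy_hom L (R_ob (T_ob L)) :=
  @MkRlcyHom L (R_ob (T_ob L)) (@psi_fun L) (psi_fun_hom L) (psi_fun_i L).

Definition psi_nat : NatTrans (idF RLcy) (compF R T).
Proof.
refine (@MkNatTrans RLcy RLcy (idF RLcy) (compF R T) psi_hom _).
intros L M f; apply rlcy_hom_eq; intro a; apply nimg_eq, tw_eq; simpl; trivial.
now rewrite (rlh_ldiv (rlcyh_rl f)), rlcyh_i.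
Defined.

Definition psi_inv_nat : NatTrans (compF R T) (idF RLcy).
Proof.
refine (@MkNatTrans RLcy RLcy (compF R T) (idF RLcy) psi_inv_hom _).
intros L M f; now apply rlcy_hom_eq.
Defined.

Theorem theorem19 :
  exists (phi : NatTrans (idF NCA) (compF T R))
         (psi : NatTrans (idF RLcy) (compF R T))
         (psi_inv : NatTrans (compF R T) (idF RLcy)),
    (forall (A : nca) (x : A), nca_fun (phi A) x = phi_fun x) /\
    (forall (L : rlcy) (a : L), rlcy_fun (psi L) a = psi_fun a) /\
    (forall L : rlcy, inverse_pair (psi L) (psi_inv L)) /\
    is_adjunction (F := R) (G := T) phi psi_inv.
Proof.
exists phi_nat, psi_nat, psi_inv_nat.
split; [reflexivity|split; [reflexivity|split]].
- intro L; split; apply rlcy_hom_eq; [reflexivity|exact (@nimg_fstK L)].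
- split.
  (* The composite sends [x] to [nca_n x], and [n] fixes its image. *)
  + intro A; apply rlcy_hom_eq; intro x; apply nimg_eq; exact (nvalK x).
  (* For [x = (a, b)], [phi_fun] pairs the images under [tw_n] of [(a, b)] and [(b, a)]; their first
     coordinates give back [(a, b)]. *)
  + intro L; apply nca_hom_eq; intro x; now apply tw_eq.
Qed.
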